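(* Let $d,d'\ge1$ and assume $f=(f^0,\dots,f^{d'}):\mathrm{dom}\,X\to\mathrm{dom}\,X'$ satisfies the scaling condition. Say that $f$ has the form $(\ast)$ if $$f(s)=\frac{f^0(s)}{L^0(s)}L(s)\quad\text{for all }s\in\mathrm{dom}\,X,\qquad(\ast)$$ where $L=(L^0,\dots,L^{d'}):\mathbb{R}^{d+1}\to\mathbb{R}^{d'+1}$ is a linear map, $f^0$ satisfies the scaling condition, and $f^0,L^0>0$ on $\{s\in\mathbb{R}^{d+1}:s^0>0\}$. 1. If $f$ is a no-arbitrage symmetry for any market and $\mathrm{Im}\,f$ is not contained in a $2$-dimensional linear subspace of $\mathbb{R}^{d'+1}$, then $f$ has the form $(\ast)$. 2. Conversely, if $f$ has the form $(\ast)$, then it is a no-arbitrage symmetry for any market.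
   Context: Coordinates of $s\in\mathbb{R}^{d+1}$ are $s=(s^0,\dots,s^d)$. The perspective function is $X(s)=(s^1/s^0,\dots,s^d/s^0)$ on $\mathrm{dom}\,X=\{s\in\mathbb{R}^{d+1}:s^0>0\}$; $X'$ is the analogous function on $\mathrm{dom}\,X'=\{s\in\mathbb{R}^{d'+1}:s^0>0\}$ with values in $\mathbb{R}^{d'}$. Scaling condition for a map $g$ on $\mathrm{dom}\,X$: for every $s\in\mathrm{dom}\,X$ and $\lambda>0$ there is $\mu_{\lambda,s}>0$ with $g(\lambda s)=\mu_{\lambda,s}g(s)$. Trajectory set: given subsets $\Sigma_i\subseteq\mathbb{R}^{d+1}$, sets $\Omega_i$ ($i\ge0$), $\Theta\subseteq\mathbb{N}$, $s_0\in\mathbb{R}^{d+1}$, $w_0\in\Omega_0$, a trajectory set $\mathcal{S}$ is a set of sequences $\mathbf{S}=\{\mathbf{S}_i=(S_i,W_i,m)\}_{i\ge0}$ with $S_i\in\Sigma_i$, $W_i\in\Omega_i$, $m\in\Theta$, $(S_0,W_0)=(s_0,w_0)$; it is assumed throughout that $S^0_i>0$ for all $i$. Put $M(\mathbf{S})=m$. A node is a pair $(\mathbf{S},k)$, $\mathbf{S}\in\mathcal{S}$, $k\ge0$, and $\mathcal{S}_{(\mathbf{S},k)}=\{\mathbf{S}'\in\mathcal{S}:\mathbf{S}'_i=\mathbf{S}_i,\ 0\le i\le k,\ M(\mathbf{S}')>k\}$. The node is arbitrage-free if $0\in\mathrm{ri}(\mathrm{co}(\{X(\hat S_{k+1})-X(S_k):\hat{\mathbf{S}}\in\mathcal{S}_{(\mathbf{S},k)}\}))$,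 where $\mathrm{co}$ is convex hull and $\mathrm{ri}$ relative interior. $f$ is a no-arbitrage symmetry for any market if for every trajectory set $\mathcal{S}$ (with $d+1$ assets) and every arbitrage-free node $(\mathbf{S},k)$ of it, the transformed node is arbitrage-free, i.e. $0\in\mathrm{ri}(\mathrm{co}(\{X'(f(\hat S_{k+1}))-X'(f(S_k)):\hat{\mathbf{S}}\in\mathcal{S}_{(\mathbf{S},k)}\}))$. (The sets $\Sigma_i,\Omega_i,\Theta$ and the initial data vary freely with the trajectory set.) *)

(* Defs.v *)
From HB Require Import structures.
From mathcomp Require Import all_boot all_order all_algebra.
From mathcomp Require Import all_classical all_reals all_analysis.
Set Implicit Arguments.
Unset Strict Implicit.
Unset Printing Implicit Defensive.
Import Order.TTheory GRing.Theory Num.Theory.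
Import numFieldNormedType.Exports.

Local Open Scope classical_set_scope.
Local Open Scope ring_scope.

Definition convex_hull (R : realType) (n : nat) (A : set 'rV[R]_n) :
    set 'rV[R]_n :=
  smallest (fun C : set 'rV[R]_n => convex_set C) A.

Definition affine_set (R : realType) (n : nat) (C : set 'rV[R]_n) : Prop :=
  forall (x y : 'rV[R]_n) (t : R), C x -> C y -> C ((1 - t) *: x + t *: y).

Definition affine_hull (R : realType) (n : nat) (A : set 'rV[R]_n) :
    set 'rV[R]_n :=
  smallest (@affine_set R n) A.

(* Interior of A for the subspace topology of its affine hull. *)
Definition relative_interior (R : realType) (n : nat) (A : set 'rV[R]_n) :
    set 'rV[R]_n :=
  [set x | affine_hull A x /\ within (affine_hull A) (nbhs x) A].

(* The coordinate s^i of s is s 0 i. *)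

Definition dom_persp (R : realType) (d : nat) : set 'rV[R]_d.+1 :=
  [set s | 0 < s 0 0].
Arguments dom_persp {R} d.

Definition persp (R : realType) (d : nat) (s : 'rV[R]_d.+1) : 'rV[R]_d :=
  \row_(i < d) (s 0 (lift ord0 i) / s 0 0).

(* Maps on dom_persp are total functions whose values outside dom_persp are
   never used. *)
Definition scaling_condition (R : realType) (d : nat) (V : lmodType R)
    (g : 'rV[R]_d.+1 -> V) : Prop :=
  forall s, dom_persp d s -> forall lambda : R, 0 < lambda ->
    exists2 mu : R, 0 < mu & g (lambda *: s) = mu *: g s.

(* The i-th term of a trajectory is a triple (S_i, W_i, m); that m does not
   depend on i is imposed in trajectory_set. The sets Omega_i are
   subsets of a common type W, which is itself arbitrary. *)

Definition trajectory (R : realType) (d : nat) (W : Type) : Type :=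
  nat -> 'rV[R]_d.+1 * W * nat.

Section Trajectory.
Context {R : realType} {d : nat} {W : Type}.
Implicit Types (T : trajectory R d W) (SS : set (trajectory R d W)).

Definition asset T (i : nat) : 'rV[R]_d.+1 := (T i).1.1.
Definition info T (i : nat) : W := (T i).1.2.
Definition horizon T : nat := (T 0%N).2.

Definition trajectory_set (Sigma : nat -> set 'rV[R]_d.+1)
    (Omega : nat -> set W) (Theta : set nat) (s0 : 'rV[R]_d.+1) (w0 : W)
    SS : Prop :=
  Omega 0%N w0 /\
  forall T, SS T ->
    [/\ forall i, Sigma i (asset T i) /\ Omega i (info T i),
        exists2 m, Theta m & forall i, (T i).2 = m,
        asset T 0%N = s0 /\ info T 0%N = w0
      & forall i, dom_persp d (asset T i)].

(* The equality of the terms of T' and T is an equality of triples. *)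
Definition node SS T (k : nat) : set (trajectory R d W) :=
  [set T' | [/\ SS T', forall i, (i <= k)%N -> T' i = T i
              & (k < horizon T')%N]].

(* The node (T, k) is arbitrage-free once every S is replaced by g S, with
   g = id for the original market. *)
Definition arbitrage_free_via (n : nat) (g : 'rV[R]_d.+1 -> 'rV[R]_n.+1)
    SS T (k : nat) : Prop :=
  relative_interior (convex_hull
    [set persp (g (asset T' k.+1)) - persp (g (asset T k))
      | T' in node SS T k]) 0.

Definition arbitrage_free SS T (k : nat) : Prop :=
  arbitrage_free_via id SS T k.

End Trajectory.

Definition no_arbitrage_symmetry (R : realType) (d d' : nat)
    (f : 'rV[R]_d.+1 -> 'rV[R]_d'.+1) : Prop :=
  forall (W : Type) (Sigma : nat -> set 'rV[R]_d.+1) (Omega : nat -> set W)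
      (Theta : set nat) (s0 : 'rV[R]_d.+1) (w0 : W)
      (SS : set (trajectory R d W)),
    trajectory_set Sigma Omega Theta s0 w0 SS ->
    forall (T : trajectory R d W) (k : nat), SS T ->
      arbitrage_free SS T k -> arbitrage_free_via f SS T k.

Definition scaled_linear_form (R : realType) (d d' : nat)
    (f : 'rV[R]_d.+1 -> 'rV[R]_d'.+1) : Prop :=
  exists L : {linear 'rV[R]_d.+1 -> 'rV[R]_d'.+1},
    [/\ forall s, dom_persp d s -> f s = (f s 0 0 / L s 0 0) *: L s,
        scaling_condition (fun s => f s 0 0 : R^o),
        forall s, dom_persp d s -> 0 < f s 0 0
      & forall s, dom_persp d s -> 0 < L s 0 0].

(* Main.v *)
(* 0 lies in the relative interior of co A iff A is nonempty and co A contains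
   some - e a, e > 0, for every a in A; this is preserved by linear images, and
   a scaled linear form acts on X(s) by an affine map.

   Conversely, two-trajectory markets show that F, defined by X' o f = F o X,
   maps the points strictly between x and y to points strictly between F x and
   F y (or to F x = F y). Such a map is constant or injective on a line. If it
   is injective on a line, choose p with F p off the line through its image
   and let w x > 0 be the weight for which F (mid(p, x)) is the barycenter of
   (F p, 1) and (F x, w x). Concurrency of medians shows that F (mid(a, b)) is the
   barycenter of (F a, w a) and (F b, w b), and the midpoints of p, a and of p, b
   then give w (mid(a, b)) = (w a + w b) / 2. A positive function with this
   property on a whole line is constant, so that F preserves midpoints, and by
   betweenness F is affine. *)
Require Import Defs.
From HB Require Import structures.
From mathcomp Require Import all_boot all_order all_algebra.
From mathcomp Require Import all_classical all_reals all_analysis.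
From mathcomp Require Import ring lra.
Set Implicit Arguments.
Unset Strict Implicit.
Unset Printing Implicit Defensive.
Import Order.TTheory GRing.Theory Num.Theory.
Import numFieldNormedType.Exports.

Local Open Scope classical_set_scope.
Local Open Scope ring_scope.

(** * Convex hulls and their relative interior at the origin *)

Section RelativeInterior.
Context {R : realType} {n : nat}.
Implicit Types (A C : set 'rV[R]_n) (x y v : 'rV[R]_n) (U V : {vspace 'rV[R]_n}).

Lemma convex_setP C :
  convex_set C <->
  forall x y (t : R), 0 <= t <= 1 -> C x -> C y -> C (t *: x + (1 - t) *: y).
Proof.
split=> [cC x y t t01 Cx Cy|cC x y t].
  have := cC x y (Itv01 (andP t01).1 (andP t01).2).
  by rewrite !inE; apply.
rewrite !inE => Cx Cy.
by apply: (cC x y t%:num) => //; rewrite ge0 le1.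
Qed.

Lemma sub_convex_hull A : A `<=` convex_hull A.
Proof. exact: sub_gen_smallest. Qed.

Lemma convex_hull_min A C : convex_set C -> A `<=` C -> convex_hull A `<=` C.
Proof. exact: smallest_sub. Qed.

Lemma convex_convex_hull A : convex_set (convex_hull A).
Proof.
apply/convex_setP => x y t t01 Ax Ay C hC.
have [/convex_setP cC _] := hC.
by apply: cC => //; [exact: (Ax C hC)|exact: (Ay C hC)].
Qed.

Lemma affine_affine_hull A : affine_set (affine_hull A).
Proof.
move=> x y t Ax Ay C hC; have [aC _] := hC.
by apply: aC; [exact: (Ax C hC)|exact: (Ay C hC)].
Qed.

Lemma coord_le_normr m (v : 'rV[R]_m) i : `|v 0 i| <= `|v|.
Proof.
rewrite [leRHS]/Num.Def.normr /= mx_normrE; apply/bigmax_geP; right => /=.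
by exists (0, i).
Qed.

Lemma linear_rV_bounded m (g : {linear 'rV[R]_n -> 'rV[R]_m}) :
  exists2 K : R, 0 < K & forall v, `|g v| <= K * `|v|.
Proof.
exists (1 + \sum_i `|g (delta_mx 0 i)|).
  by rewrite ltr_pwDl// sumr_ge0.
move=> v; rewrite {1}(row_sum_delta v) linear_sum mulrDl mul1r.
apply: le_trans (ler_norm_sum _ _ _) _; rewrite mulr_suml.
rewrite -[leLHS]add0r lerD//; apply: ler_sum => i _.
by rewrite linearZ /= normrZ mulrC ler_wpM2l// coord_le_normr.
Qed.

(** [C] contains a ball around 0 of the subspace [U]. Naming the subspace lets it be enlarged step
    by step. *)
Definition locally_in C U := exists2 e : R, 0 < e &
  forall v, v \in U -> `|v| < e -> C v.

Lemma locally_in_line C v (e : R) : convex_set C -> 0 < e ->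
  C v -> C (- e *: v) -> locally_in C <[v]>%VS.
Proof.
move=> /convex_setP cC e0 Cv Cev.
have [v0|v0] := eqVneq v 0.
  exists 1 => // w; rewrite v0 => /vlineP[k ->] _.
  by rewrite scaler0 -v0.
have nv : 0 < `|v| by rewrite normr_gt0.
pose r := Num.min 1 e.
have [r1 re] : r <= 1 /\ r <= e by rewrite !ge_min !lexx orbT.
exists (r * `|v|); first by rewrite mulr_gt0// lt_min ltr01.
move=> _ /vlineP[k ->]; rewrite normrZ ltr_pM2r// ltr_norml => /andP[k1 k2].
have e1 : 1 + e != 0 by rewrite gt_eqF// addr_gt0.
(* The weight [t = (k + e) / (1 + e)] solves [t - (1 - t) * e = k]. *)
have -> : k *: v = (k + e) / (1 + e) *: v + (1 - (k + e) / (1 + e)) *: (- e *: v).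
  by rewrite scalerA -scalerDl; congr (_ *: _); field.
apply: cC => //.
by rewrite divr_ge0 ?ler_pdivrMr ?mul1r ?addr_gt0 /=; lra.
Qed.

(** A vector of [U + V] is the midpoint of the doubles of its two components, and these are small
    because the projections are bounded. *)
Lemma locally_in_add C U V : convex_set C ->
  locally_in C U -> locally_in C V -> locally_in C (U + V).
Proof.
move=> /convex_setP cC [e e0 CU] [r r0 CV].
have [K K0 bK] := linear_rV_bounded (addv_pi1 U V).
have [K' K'0 bK'] := linear_rV_bounded (addv_pi2 U V).
exists (Num.min (e / (2 * K)) (r / (2 * K'))).
  by rewrite lt_min !divr_gt0// mulr_gt0.
move=> w wUV; rewrite lt_min !ltr_pdivlMr ?mulr_gt0// => /andP[we wr].
have -> : w = 2^-1 *: (2 *: addv_pi1 U V w) + (1 - 2^-1) *: (2 *: addv_pi2 U V w).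
  rewrite -{1}(addv_pi1_pi2 wUV) !scalerA mulVf// scale1r.
  by have -> : (1 - 2^-1) * 2 = 1 :> R; [field|rewrite scale1r].
have nn (x : 'rV[R]_n) : `|2 *: x| = 2 * `|x| by rewrite normrZ gtr0_norm.
apply: cC; first lra.
- apply: CU; first by rewrite memvZ// memv_pi1.
  by rewrite nn; have := bK w; lra.
- apply: CV; first by rewrite memvZ// memv_pi2.
  by rewrite nn; have := bK' w; lra.
Qed.

(* Take a subspace of maximal dimension among those that the hull covers near
   0: adding a line through a point of A cannot increase its dimension. *)
Lemma locally_in_span A : A !=set0 ->
  (forall a, A a -> exists2 e : R, 0 < e & convex_hull A (- e *: a)) ->
  exists2 U : {vspace _}, A `<=` [set v | v \in U] & locally_in (convex_hull A) U.
Proof.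
move=> [a0 Aa0] hA.
have cA := @convex_convex_hull A.
have line a : A a -> locally_in (convex_hull A) <[a]>%VS.
  move=> Aa; have [e e0 Ae] := hA a Aa.
  exact: (locally_in_line cA e0 (sub_convex_hull Aa) Ae).
pose P k := `[< exists2 U : {vspace 'rV[R]_n}, locally_in (convex_hull A) U &
                \dim U = k >].
have exP : exists k, P k.
  by exists (\dim <[a0]>); apply/asboolP; exists <[a0]>%VS => //; exact: line.
have ubP k : P k -> (k <= \dim {:'rV[R]_n})%N.
  by move=> /asboolP[U _ <-]; rewrite dimvS// subvf.
have [k /asboolP[U locU dU] maxk] := ex_maxnP exP ubP.
exists U => // a Aa /=.
have /maxk : P (\dim (U + <[a]>)).
  apply/asboolP; exists (U + <[a]>)%VS => //.
  exact: locally_in_add (line a Aa).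
rewrite -dU => dle.
have : (<[a]> <= U)%VS.
  have /eqP -> : (U == U + <[a]>)%VS by rewrite eqEdim addvSl.
  exact: addvSr.
by rewrite memvE.
Qed.

(** Replaces topology by algebra. Forwards, the affine hull contains the line through 0 and [a], so
    a short step against [a] stays in the hull. Backwards, the subspace covered near 0 contains [A],
    hence also the affine hull. *)
Lemma relative_interior_hull0 A :
  relative_interior (convex_hull A) 0 <->
  A !=set0 /\
  (forall a, A a -> exists2 e : R, 0 < e & convex_hull A (- e *: a)).
Proof.
split=> [[aff0 /nbhs_ballP[r /= r0 sub]]|[A0 hA]].
  split.
    apply/set0P/eqP => A0; apply: (aff0 set0); split=> //.
    by rewrite A0; apply: convex_hull_min => //; apply/convex_setP.
  move=> a Aa; have na : 0 < `|a| + 1 by rewrite ltr_wpDl.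
  (* The summand 1 keeps the denominator positive when [a = 0]. *)
  pose e := r / (2 * (`|a| + 1)).
  have e0 : 0 < e by rewrite divr_gt0// mulr_gt0.
  exists e => //; apply: sub.
    rewrite -ball_normE /= sub0r normrN normrZ normrN gtr0_norm//.
    rewrite /e mulrAC ltr_pdivrMr ?mulr_gt0// ltr_pM2l//.
    by have := normr_ge0 a; lra.
  have := @affine_affine_hull (convex_hull A) 0 a (- e) aff0.
  rewrite scaler0 add0r; apply.
  by apply: sub_gen_smallest; exact: sub_convex_hull.
have [U AU [e e0 CU]] := locally_in_span A0 hA.
have hU : affine_hull (convex_hull A) `<=` [set v | v \in U].
  apply: smallest_sub; first by move=> x y t /= Ux Uy; rewrite memvD ?memvZ.
  apply: convex_hull_min => //; apply/convex_setP => x y t _ /= Ux Uy.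
  by rewrite memvD ?memvZ.
split.
  by apply: sub_gen_smallest; apply: CU; rewrite ?mem0v// normr0.
apply/nbhs_ballP; exists e => //= v.
rewrite -ball_normE /= sub0r normrN => ve /hU /= vU.
exact: CU.
Qed.

Lemma convex_hull_pair x y v : convex_hull [set x; y] v ->
  exists2 t : R, 0 <= t <= 1 & v = t *: x + (1 - t) *: y.
Proof.
move: v; apply: (@convex_hull_min _
  [set v | exists2 t : R, 0 <= t <= 1 & v = t *: x + (1 - t) *: y]).
  apply/convex_setP => _ _ t /andP[t0 t1] [s /andP[s0 s1] ->] [r /andP[r0 r1] ->].
  exists (t * s + (1 - t) * r); first by apply/andP; split; nra.
  rewrite !scalerDr !scalerA addrACA -!scalerDl.
  by congr (_ *: _ + _ *: _); ring.
move=> _ [->|->].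
  by exists 1; rewrite ?lexx ?ler01// scale1r subrr scale0r addr0.
by exists 0; rewrite ?lexx ?ler01// scale0r subr0 scale1r add0r.
Qed.
End RelativeInterior.

Lemma convex_hull_linear (R : realType) m n
    (g : {linear 'rV[R]_m -> 'rV[R]_n}) (A : set 'rV[R]_m) v :
  convex_hull A v -> convex_hull (g @` A) (g v).
Proof.
move: v; apply: (@convex_hull_min _ _ _ (g @^-1` convex_hull (g @` A))).
  apply/convex_setP => x y t t01 Cx Cy; rewrite /preimage /= linearD !linearZ /=.
  have /convex_setP := @convex_convex_hull _ _ (g @` A).
  exact.
by move=> a Aa; apply: sub_convex_hull; exists a.
Qed.

(** * Midpoint-preserving real functions *)

Lemma natmul_bounded_le0 (R : realType) (x C : R) :
  (forall k : nat, k%:R * x <= C) -> x <= 0.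
Proof.
move=> kx; rewrite leNgt; apply/negP => x0.
have := kx (Num.truncn (C / x)).+1.
by rewrite -ler_pdivlMr// leNgt truncnS_gt.
Qed.

Section MidpointConvexity.
Context {R : realType} (g : R -> R).
Hypothesis g_mid : forall s t, g ((s + t) / 2) = (g s + g t) / 2.

(** Induction: [k * t] and [t] have the same midpoint as [(k + 1) * t] and 0. *)
Lemma midpoint_natmul (k : nat) t : g (k%:R * t) = g 0 + k%:R * (g t - g 0).
Proof.
elim: k => [|k IHk]; first by rewrite !mul0r addr0.
have /eqP := g_mid (k%:R * t) t.
have := g_mid (k.+1%:R * t) 0; rewrite addr0.
have -> : k%:R * t + t = k.+1%:R * t by rewrite -natr1; ring.
by rewrite IHk -natr1 => -> /eqP; lra.
Qed.

(** The increments at [t] and [- t] are opposite, and positivity bounds the natural multiples of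
    both from below, so both vanish. *)
Lemma midpoint_gt0_const t : (forall s, 0 < g s) -> g t = g 0.
Proof.
move=> g0; pose z := g t - g 0; pose z' := g (- t) - g 0.
have z'E : z' = - z.
  have := g_mid t (- t); rewrite subrr mul0r /z /z'.
  by lra.
have h1 : - z <= 0.
  apply: (@natmul_bounded_le0 _ _ (g 0)) => k.
  by have := g0 (k%:R * t); rewrite midpoint_natmul -/z; lra.
have h2 : - z' <= 0.
  apply: (@natmul_bounded_le0 _ _ (g 0)) => k.
  by have := g0 (k%:R * (- t)); rewrite midpoint_natmul -/z'; lra.
by move: h1 h2; rewrite z'E /z; lra.
Qed.

(** Betweenness takes the place of continuity: [g] fixes the integers and keeps every other [s]
    between its two neighbouring integers, so [g s] is within 1 of [s]. Taking [s = k * t] for all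
    natural [k] makes the error at [t] vanish. *)
Lemma midpoint_between_id t : g 0 = 0 -> g 1 = 1 ->
  (forall s r (c : R), 0 < c < 1 -> exists2 u : R, 0 < u < 1 &
     g (s + c * (r - s)) = g s + u * (g r - g s)) ->
  g t = t.
Proof.
move=> g0 g1 g_btw.
have gM (k : nat) s : g (k%:R * s) = k%:R * g s.
  by rewrite midpoint_natmul g0 add0r subr0.
have gN s : g (- s) = - g s.
  by have := g_mid s (- s); rewrite subrr mul0r g0; lra.
have gnat (k : nat) : g k%:R = k%:R by rewrite -[LHS](congr1 g (mulr1 _)) gM g1 mulr1.
have gint (m : int) : g m%:~R = m%:~R.
  by case: m => k; rewrite ?NegzE ?rmorphN ?gN /= ?gnat.
have bound s : `|g s - s| <= 1.
  have /andP[ms sm] := floor_itv s.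
  have [ms'|ms'] := eqVneq (Num.floor s)%:~R s.
    by rewrite -ms' gint subrr normr0.
  have c01 : 0 < s - (Num.floor s)%:~R < 1.
    move: sm; rewrite intrD => sm.
    by rewrite subr_gt0 lt_neqAle ms' ms /=; lra.
  have [u u01] := g_btw (Num.floor s)%:~R (Num.floor s + 1)%:~R _ c01.
  rewrite !gint intrD addrAC subrr add0r !mulr1 addrC subrK => ->.
  by rewrite ler_norml; lra.
have bd (y : R) : (forall k : nat, `|k%:R * y| <= 1) -> y = 0.
  move=> hy; apply/eqP; rewrite eq_le; apply/andP; split.
    by apply: (@natmul_bounded_le0 _ _ 1) => k; have := hy k; rewrite ler_norml; lra.
  rewrite -oppr_le0; apply: (@natmul_bounded_le0 _ _ 1) => k.
  by have := hy k; rewrite ler_norml; lra.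
apply/subr0_eq/bd => k; have := bound (k%:R * t).
by rewrite gM mulrBr.
Qed.
End MidpointConvexity.

(** * Maps that send open segments into open segments *)

Section PlaneCoordinates.
Context {R : realType} {V : lmodType R} (o e f : V).

Definition plane_pt (x y : R) : V := o + x *: e + y *: f.

Lemma plane_pt_comb x y x' y' t :
  plane_pt x y + t *: (plane_pt x' y' - plane_pt x y) =
  plane_pt (x + t * (x' - x)) (y + t * (y' - y)).
Proof.
rewrite /plane_pt; have -> : o + x' *: e + y' *: f - (o + x *: e + y *: f) =
  (x' - x) *: e + (y' - y) *: f.
  by rewrite !scalerBl !opprD addrACA [(o + x' *: e) + _]addrACA subrr add0r.
by rewrite scalerDr !scalerA addrACA -(addrA o) -!scalerDl.
Qed.
End PlaneCoordinates.

Section SegmentMaps.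
Context {R : realType} {X V : lmodType R} (F : X -> V).
Hypothesis F_seg : forall x y (t : R), 0 < t < 1 ->
  exists2 u : R, 0 < u < 1 & F (x + t *: (y - x)) = F x + u *: (F y - F x).

(** Here [b] lies between [a] and the given point, at parameter [1 / t]; the relation between the
    images is then solved for the far point. *)
Lemma segment_map_ray a b t : 1 < t -> exists2 u : R, 0 < u &
  F (a + t *: (b - a)) = F a + u *: (F b - F a).
Proof.
move=> t1; set z := a + _.
have [|u /andP[u0 u1] Fb] := F_seg a z (t := t^-1).
  by rewrite invr_gt0 invf_lt1 ?t1 (lt_trans _ t1).
exists u^-1; rewrite ?invr_gt0//.
have -> : b = a + t^-1 *: (z - a).
  rewrite /z addrAC subrr add0r scalerA mulVf ?scale1r ?subrKC//.
  by rewrite gt_eqF// (lt_trans _ t1).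
by rewrite Fb addrAC subrr add0r scalerA mulVf ?gt_eqF// scale1r subrKC.
Qed.

Lemma segment_map_collinear a b t : exists u,
  F (a + t *: (b - a)) = F a + u *: (F b - F a).
Proof.
have [t1|t1|->] := ltrgtP t 1; last by exists 1; rewrite !scale1r !subrKC.
  have [t0|t0|->] := ltrgtP t 0; last by exists 0; rewrite !scale0r !addr0.
    (* For [t < 0] the point lies beyond [a] on the ray from [b]. *)
    have [|u _] := @segment_map_ray b a (1 - t); first lra.
    have -> : b + (1 - t) *: (a - b) = a + t *: (b - a).
      by rewrite scalerBl scale1r addrA subrKC -scalerN opprB.
    move=> ->; exists (1 - u).
    by rewrite scalerBl scale1r addrA subrKC -scalerN opprB.
  by have [|u _ ->] := F_seg a b (t := t); [rewrite t0|exists u].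
by have [u _ ->] := segment_map_ray a b t1; exists u.
Qed.

Lemma segment_map_line_const a b t : F a = F b -> F (a + t *: (b - a)) = F a.
Proof.
move=> Fab; have [u ->] := segment_map_collinear a b t.
by rewrite Fab subrr scaler0 addr0.
Qed.

Section Line.
Variables (a b p : X).
Hypothesis Fab : F a != F b.
Hypothesis Fp : forall u, F p != F a + u *: (F b - F a).

(** Matching frames: [a], [b], [p] and their images have coordinates (0, 0), (0, 1) and (1, 0). The
    line through [a] and [b] is the axis with first coordinate 0. *)
Let src := plane_pt a (p - a) (b - a).
Let tgt := plane_pt (F a) (F p - F a) (F b - F a).

Let tgt_inj x y x' y' : tgt x y = tgt x' y' -> x = x' /\ y = y'.
Proof.
move=> /eqP; rewrite -subr_eq0 /tgt /plane_pt.
set e := F p - _; set f := F b - _.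
have f0 : f != 0 by rewrite subr_eq0 eq_sym.
rewrite -(addrA _ (x *: e)) -(addrA _ (x' *: e)) opprD addrACA subrr add0r.
rewrite opprD addrACA -!scalerBl.
move=> E0; have [xx'|xx'] := eqVneq x x'.
  move: E0; rewrite xx' subrr scale0r add0r scaler_eq0 (negPf f0) orbF subr_eq0.
  by move/eqP.
have x0 : x - x' != 0 by rewrite subr_eq0.
(* If the first coordinates differ, the equation can be solved for [F p], which puts it on the line
   through [F a] and [F b]. *)
have := Fp (- ((y - y') / (x - x'))); rewrite addrC -subr_eq -/e -/f.
case/eqP; apply: (scalerI x0); rewrite scalerA mulrN mulrC divfK// scaleNr.
by apply/eqP; rewrite -subr_eq0 opprK.
Qed.

Let src_p : src 1 0 = p.
Proof. by rewrite /src /plane_pt scale1r scale0r addr0 subrKC. Qed.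

Let F_line : exists h : R -> R, forall t, F (src 0 t) = tgt 0 (h t).
Proof.
suff /choice[h hE] : forall t, exists u, F (src 0 t) = tgt 0 u by exists h.
move=> t; have [u Fu] := segment_map_collinear a b t; exists u.
by rewrite /src /tgt /plane_pt !scale0r !addr0.
Qed.

Let F_src x y x' y' z w z' w' (c : R) : 0 < c < 1 ->
  F (src x y) = tgt z w -> F (src x' y') = tgt z' w' ->
  exists2 u : R, 0 < u < 1 &
  F (src (x + c * (x' - x)) (y + c * (y' - y))) =
  tgt (z + u * (z' - z)) (w + u * (w' - w)).
Proof.
move=> c01 E E'; have [u u01 Fu] := F_seg (src x y) (src x' y') c01.
by exists u => //; rewrite /src -plane_pt_comb Fu E E' /tgt plane_pt_comb.
Qed.

Lemma segment_map_line_affine t : F (a + t *: (b - a)) = F a + t *: (F b - F a).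
Proof.
have [h hE] := F_line.
suff ht : h t = t by have := hE t; rewrite ht /src /tgt /plane_pt !scale0r !addr0.
have Fa0 : F (src 0 0) = tgt 0 0 by rewrite /src /tgt /plane_pt !scale0r !addr0.
have Fb1 : F (src 0 1) = tgt 0 1.
  by rewrite /src /tgt /plane_pt !scale0r !addr0 !scale1r !subrKC.
have h0 : h 0 = 0 by have := hE 0; rewrite Fa0 => /tgt_inj[].
have h1 : h 1 = 1 by have := hE 1; rewrite Fb1 => /tgt_inj[].
have Fp1 : F (src 1 0) = tgt 1 0.
  by rewrite src_p /tgt /plane_pt scale1r scale0r addr0 subrKC.
have h_inj s r : s != r -> h s != h r.
  move=> sr; apply: contra_neq Fab => hsr.
  have Fsr : F (src 0 s) = F (src 0 r) by rewrite !hE hsr.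
  have rs : r - s != 0 by rewrite subr_eq0 eq_sym.
  have cst c : F (src 0 (s + c * (r - s))) = F (src 0 s).
    rewrite -(segment_map_line_const c Fsr) /src plane_pt_comb.
    by rewrite subrr mulr0 addr0.
  (* If two points of the line have the same image, the whole line collapses; these parameters reach
     [a] and [b], whose images differ. *)
  have := cst (- s / (r - s)); rewrite divfK// subrr Fa0 => E0.
  have := cst ((1 - s) / (r - s)); rewrite divfK// subrKC Fb1 -E0.
  by move=> /tgt_inj[_ /eqP]; rewrite oner_eq0.
have dbl (x : R) : (x + x) / 2 = x by field.
have half : 0 < (2^-1 : R) < 1 by lra.
have h_btw s r (c : R) : 0 < c < 1 -> exists2 u : R, 0 < u < 1 &
    h (s + c * (r - s)) = h s + u * (h r - h s).
  move=> c01; have [u u01] := F_src c01 (hE s) (hE r).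
  rewrite subrr mulr0 addr0 hE => /tgt_inj[_ hu].
  by exists u.
(* Write x_s for [src 0 s]; the midpoint of [p] and x_s is [src 2^-1 (s / 2)]. *)
have /choice[u uE] : forall s, exists u : R, 0 < u < 1 /\
    F (src 2^-1 (s / 2)) = tgt (1 - u) (u * h s).
  move=> s; have [u u01] := F_src half Fp1 (hE s).
  rewrite !sub0r !subr0 !add0r mulrN1 mulrN mulr1 => Fs.
  exists u; split=> //; rewrite -Fs; by congr (F (src _ _)); lra.
(* The image of the midpoint of [p, x_s] is the mean of the images of p and x_s
   with weights 1 and [w s]. *)
pose w s := u s / (1 - u s).
have u01 s : 0 < u s < 1 by have [] := uE s.
have w_gt0 s : 0 < w s by rewrite divr_gt0//; have := u01 s; lra.
have w_u s : u s = w s * (1 - u s).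
  by rewrite divfK// gt_eqF//; have := u01 s; lra.
(* Ceva: the images of the medians of the triangle p, x_s, x_r are concurrent. *)
have h_mean s r : s != r ->
    (w s + w r) * h ((s + r) / 2) = w s * h s + w r * h r.
  move=> sr; set m := (s + r) / 2.
  (* The centroid lies two thirds of the way along each median. The parameters [k], [l], [j] locate
     its image on the images of the medians from x_s, x_r and [p]. *)
  have two3 : 0 < (2 / 3 : R) < 1 by lra.
  have [_ us] := uE s; have [_ ur] := uE r.
  have [k k01 Ek] := F_src two3 (hE s) ur.
  have [l l01 El] := F_src two3 (hE r) us.
  have [j j01 Ej] := F_src two3 Fp1 (hE m).
  have cE : (0 + 2 / 3 * (2^-1 - 0), s + 2 / 3 * (r / 2 - s)) =
            (1 + 2 / 3 * (0 - 1), 0 + 2 / 3 * (m - 0)) :> R * R.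
    by congr pair; rewrite /m; field.
  have cE' : (0 + 2 / 3 * (2^-1 - 0), r + 2 / 3 * (s / 2 - r)) =
             (1 + 2 / 3 * (0 - 1), 0 + 2 / 3 * (m - 0)) :> R * R.
    by congr pair; rewrite /m; field.
  case: cE => cE1 cE2; case: cE' => cE1' cE2'.
  move: Ek El; rewrite cE1 cE2 cE2' Ej.
  move=> /tgt_inj[k1 k2] /tgt_inj[l1 l2].
  have hsr : h r - h s != 0 by rewrite subr_eq0 eq_sym h_inj.
  (* [K] is the first coordinate of the image of the centroid; the other two medians express it as
     [k * (1 - u r)] and [l * (1 - u s)]. *)
  set K := 1 - j.
  have K0 : 0 < K by rewrite /K; lra.
  have kw : k * u r = K * w r.
    rewrite {1}w_u /K; have -> : 1 - j = k * (1 - u r) by lra.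
    by ring.
  have lw : l * u s = K * w s.
    rewrite {1}w_u /K; have -> : 1 - j = l * (1 - u s) by lra.
    by ring.
  have E1 : j * h m = j * h s + K * w r * (h r - h s).
    have kk : k = K + K * w r by rewrite -kw /K; lra.
    have -> : j * h m = h s - k * h s + (k * u r) * h r by lra.
    rewrite kw {1}kk.
    have -> : j = 1 - K by rewrite /K; ring.
    by ring.
  have E2 : j * h m = j * h r + K * w s * (h s - h r).
    have ll : l = K + K * w s by rewrite -lw /K; lra.
    have -> : j * h m = h r - l * h r + (l * u s) * h s by lra.
    rewrite lw {1}ll.
    have -> : j = 1 - K by rewrite /K; ring.
    by ring.
  (* Difference of [E1] and [E2], divided by [h r - h s]. *)
  have jE : j = K * (w s + w r).
    by apply: (mulIf hsr); move: E1 E2; lra.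
  apply: (mulfI (lt0r_neq0 K0)).
  rewrite mulrA -jE E1 jE.
  by ring.
(* The midpoint of p and x_m is also the midpoint of those of p, x_s and p, x_r. *)
have w_mid s r : w ((s + r) / 2) = (w s + w r) / 2.
  have [->|sr] := eqVneq s r.
    by rewrite !dbl.
  have := h_mean _ _ sr; set m := (s + r) / 2 => hm.
  have [_ us] := uE s; have [_ ur] := uE r; have [_ um] := uE m.
  have [q q01] := F_src half us ur.
  rewrite subrr mulr0 addr0.
  have -> : s / 2 + 2^-1 * (r / 2 - s / 2) = m / 2 by rewrite /m; field.
  rewrite um => /tgt_inj[z1 z2].
  have hsr : h r - h s != 0 by rewrite subr_eq0 eq_sym h_inj.
  have zE : u m = (1 - q) * u s + q * u r by lra.
  (* Inserting [h m] into the second coordinate and cancelling [h r - h s] leaves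
     [(1 - q) * u s * w r = q * u r * w s]; then each [u] is written as [w * (1 - u)]. Thus both
     midpoints contribute equally to the coordinate along [p]. *)
  have q_eq : (1 - q) * (1 - u s) = q * (1 - u r).
    have W0 : w s + w r != 0 by rewrite gt_eqF// addr_gt0.
    have hmE : h m = (w s * h s + w r * h r) / (w s + w r) by rewrite -hm mulrC mulKf.
    move: z2; rewrite zE hmE.
    move=> /(congr1 (fun x => x * (w s + w r))).
    rewrite mulrA divfK// => z2.
    have : (h r - h s) * ((1 - q) * u s * w r - q * u r * w s) = 0 by lra.
    move/eqP; rewrite mulf_eq0 (negPf hsr)/= => /eqP z3.
    apply/subr0_eq/(mulfI (lt0r_neq0 (mulr_gt0 (w_gt0 s) (w_gt0 r)))).
    by rewrite mulr0 -z3 [in RHS](w_u s) [in RHS](w_u r); ring.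
  have d0 : 1 - u m != 0 by rewrite gt_eqF//; have := u01 m; lra.
  apply: (mulIf d0); rewrite -w_u.
  have -> : 1 - u m = 2 * (q * (1 - u r)) by lra.
  have us' : (1 - q) * u s = w s * (q * (1 - u r)) by rewrite -q_eq {1}w_u; ring.
  have ur' : q * u r = w r * (q * (1 - u r)) by rewrite {1}w_u; ring.
  by rewrite zE us' ur'; field.
have w_const s : w s = w 0 by exact: midpoint_gt0_const.
have h_mid s r : h ((s + r) / 2) = (h s + h r) / 2.
  have [->|sr] := eqVneq s r.
    by rewrite !dbl.
  have := h_mean _ _ sr; rewrite (w_const s) (w_const r) => hm.
  by apply: (mulfI (lt0r_neq0 (w_gt0 0))); lra.
exact: midpoint_between_id.
Qed.
End Line.

Hypothesis F_noncollinear : forall a b, F a != F b ->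
  exists p, forall u, F p != F a + u *: (F b - F a).

Lemma segment_map_affine a b t :
  F (a + t *: (b - a)) = F a + t *: (F b - F a).
Proof.
have [Fab|Fab] := eqVneq (F a) (F b).
  by rewrite segment_map_line_const// Fab subrr scaler0 addr0.
have [p Fp] := F_noncollinear Fab.
exact: segment_map_line_affine Fp t.
Qed.
End SegmentMaps.

(** Lines through 0 give homogeneity; additivity comes from doubling the image of the midpoint of
    two points. *)
Lemma affine_sub0_linear (R : realType) (X V : lmodType R) (F : X -> V) :
  (forall a b t, F (a + t *: (b - a)) = F a + t *: (F b - F a)) ->
  linear (fun x => F x - F 0).
Proof.
move=> F_aff.
have FZ t x : F (t *: x) - F 0 = t *: (F x - F 0).
  by have := F_aff 0 x t; rewrite add0r subr0 => ->; rewrite addrAC subrr add0r.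
move=> t x y; rewrite -FZ; set z := t *: x.
have Fz2 : 2^-1 *: (z + y) = z + 2^-1 *: (y - z).
  rewrite scalerDr scalerBr addrCA addrC; congr (_ + _).
  by rewrite -{2}[z]scale1r -scalerBl; congr (_ *: _); field.
have := FZ 2^-1 (z + y); rewrite Fz2 F_aff => /(congr1 (fun v => 2 *: v)).
rewrite scalerA mulfV// scale1r => <-.
rewrite addrAC scalerDr scalerA mulfV// scale1r.
have -> : F y - F z = (F y - F 0) - (F z - F 0) by rewrite opprB addrA subrK.
rewrite scaler_nat mulr2n -addrA; congr (_ + _).
by rewrite subrKC.
Qed.

(** The form that absence of arbitrage takes with two outcomes [x], [y] and present value [z]; the
    degenerate case [x = y = z] is included. *)
Lemma relative_interior_pair (R : realType) n (x y z : 'rV[R]_n) :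
  relative_interior (convex_hull [set x - z; y - z]) 0 <->
  exists2 u : R, 0 < u < 1 & z = x + u *: (y - x).
Proof.
rewrite relative_interior_hull0; split=> [[_ hull]|[u /andP[u0 u1] zE]].
  have [xz|xz] := eqVneq x z.
    have [|e e0] := hull (y - z); first by right.
    (* With [x = z] the hull is the segment from 0 to [y - z], which contains a negative multiple of
       [y - z] only if [y = z]. *)
    move=> /convex_hull_pair[t /andP[t0 t1]]; rewrite xz subrr scaler0 add0r.
    move/eqP; rewrite -subr_eq0 -scalerBl scaler_eq0 => /orP[/eqP|/eqP yz].
      by lra.
    by exists 2^-1; [lra|rewrite yz scaler0 addr0].
  have [|e e0] := hull (x - z); first by left.
  move=> /convex_hull_pair[t /andP[t0 t1]].
  have -> : y - z = (y - x) + (x - z) by rewrite addrA subrK.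
  rewrite [(1 - t) *: _]scalerDr addrCA -scalerDl subrKC scale1r => E.
  have e1 : 1 + e != 0 by rewrite lt0r_neq0// addr_gt0.
  have E' : (1 - t) *: (y - x) = (1 + e) *: (z - x).
    rewrite -(opprB x z) scalerN [(1 + e) *: _]scalerDl scale1r opprD.
    by rewrite -scaleNr E addrCA addNr addr0.
  exists ((1 - t) / (1 + e)); last first.
    by rewrite mulrC -scalerA E' scalerA mulVf// scale1r subrKC.
  have t_neq1 : t != 1.
    apply: contra_neq xz => t1E.
    move/eqP: E'; rewrite t1E subrr scale0r eq_sym scaler_eq0 (negPf e1) subr_eq0.
    by move/eqP.
  have t1' : t < 1 by rewrite lt_neqAle t_neq1.
  have e1' : 0 < 1 + e by rewrite addr_gt0.
  by rewrite divr_gt0 ?subr_gt0// ltr_pdivrMr// mul1r; lra.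
split; first by exists (x - z); left.
have xzE : x - z = - u *: (y - x) by rewrite zE opprD addrA subrr add0r scaleNr.
have yzE : y - z = (1 - u) *: (y - x).
  by rewrite scalerBl scale1r zE opprD addrA.
move=> _ [->|->].
  (* This factor carries [x - z] exactly to the other generator [y - z]. *)
  exists ((1 - u) / u); first by rewrite divr_gt0// subr_gt0.
  have -> : - ((1 - u) / u) *: (x - z) = y - z.
    by rewrite xzE yzE scalerA mulrNN divfK// lt0r_neq0.
  by apply: sub_convex_hull; right.
exists (u / (1 - u)); first by rewrite divr_gt0// subr_gt0.
have -> : - (u / (1 - u)) *: (y - z) = x - z.
  by rewrite xzE yzE scalerA mulNr divfK// lt0r_neq0// subr_gt0.
by apply: sub_convex_hull; left.
Qed.

Lemma linear_packed (R : pzRingType) (U V : lmodType R) (g : U -> V) :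
  linear g -> exists L : {linear U -> V}, L =1 g.
Proof.
move=> g_lin.
pose L : {linear U -> V} := HB.pack g (GRing.isLinear.Build _ _ _ _ g g_lin).
by exists L.
Qed.

(** * Homogeneous coordinates and the perspective function *)

Section Perspective.
Context {R : realType}.

(** With [c = 1] this is a section of the perspective function; with [c = 0] it gives the directions
    of that affine chart. *)
Definition rV_cons d (c : R) (x : 'rV[R]_d) : 'rV[R]_d.+1 :=
  \row_i (if unlift ord0 i is Some j then x 0 j else c).

Lemma rV_cons0 d c (x : 'rV[R]_d) : rV_cons c x 0 0 = c.
Proof. by rewrite mxE unlift_none. Qed.

Lemma rV_consS d c (x : 'rV[R]_d) i : rV_cons c x 0 (lift ord0 i) = x 0 i.
Proof. by rewrite mxE liftK. Qed.

Lemma rV_consP d (s t : 'rV[R]_d.+1) : s 0 0 = t 0 0 ->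
  (forall i, s 0 (lift ord0 i) = t 0 (lift ord0 i)) -> s = t.
Proof. by move=> st0 stS; apply/rowP => i; case: (unliftP ord0 i) => [j|] ->. Qed.

Lemma rV_cons_comb d a c c' (x x' : 'rV[R]_d) :
  a *: rV_cons c x + rV_cons c' x' = rV_cons (a * c + c') (a *: x + x').
Proof.
by apply: rV_consP => [|i]; rewrite !(mxE, rV_cons0, rV_consS) ?unlift_none ?liftK ?mxE.
Qed.

Lemma rV_consZ d a c (x : 'rV[R]_d) : a *: rV_cons c x = rV_cons (a * c) (a *: x).
Proof. by apply: rV_consP => [|i]; rewrite mxE ?rV_cons0 ?rV_consS ?mxE. Qed.

Lemma persp_cons d (x : 'rV[R]_d) : persp (rV_cons 1 x) = x.
Proof. by apply/rowP => i; rewrite mxE rV_consS rV_cons0 divr1. Qed.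

Lemma dom_persp_cons d (x : 'rV[R]_d) : dom_persp d (rV_cons 1 x).
Proof. by rewrite /dom_persp /= rV_cons0. Qed.

Lemma persp_scale d a (s : 'rV[R]_d.+1) : a != 0 -> persp (a *: s) = persp s.
Proof.
by move=> a0; apply/rowP => i; rewrite !mxE -mulf_div divff// mul1r.
Qed.

Lemma dom_persp_consE d (s : 'rV[R]_d.+1) : dom_persp d s ->
  s = s 0 0 *: rV_cons 1 (persp s).
Proof.
rewrite /dom_persp /= => s0; apply: rV_consP => [|i].
  by rewrite mxE rV_cons0 mulr1.
by rewrite mxE rV_consS mxE mulrC divfK// lt0r_neq0.
Qed.

(** By scaling, [persp (f s)] depends only on [persp s], so [f] induces a map between the affine
    charts. *)
Lemma persp_scaling d d' (f : 'rV[R]_d.+1 -> 'rV[R]_d'.+1) s :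
  scaling_condition f -> dom_persp d s ->
  persp (f s) = persp (f (rV_cons 1 (persp s))).
Proof.
move=> f_scal s0.
have [mu mu0 E] := f_scal _ (dom_persp_cons (persp s)) _ s0.
by rewrite {1}(dom_persp_consE s0) E persp_scale// lt0r_neq0.
Qed.

(** * Markets with two trajectories *)

Section TwoPointMarket.
Variables (d : nat) (x y z : 'rV[R]_d).

(** All paths share the price at time 0 and split at time 1. The horizon 1 exceeds 0, so the initial
    node keeps both. *)
Let path (b : bool) : trajectory R d unit := fun i =>
  (if i is 0%N then rV_cons 1 z else rV_cons 1 (if b then x else y), tt, 1%N).

Lemma two_point_trajectory_set :
  trajectory_set (fun=> setT) (fun=> setT) setT (rV_cons 1 z) tt (range path).
Proof.
split=> // _ [b _ <-]; split=> //; first by exists 1%N.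
by case=> [|i]; exact: dom_persp_cons.
Qed.

Lemma two_point_arbitrage_free n (g : 'rV[R]_d.+1 -> 'rV[R]_n.+1) :
  let G v := persp (g (rV_cons 1 v)) in
  arbitrage_free_via g (range path) (path true) 0 <->
  exists2 u : R, 0 < u < 1 & G z = G x + u *: (G y - G x).
Proof.
move=> G; rewrite -relative_interior_pair /arbitrage_free_via.
suff -> : [set persp (g (asset T' 1)) - persp (g (asset (path true) 0))
          | T' in node (range path) (path true) 0] = [set G x - G z; G y - G z] by [].
have pathN b : node (range path) (path true) 0 (path b).
  by split=> // -[].
apply/seteqP; split=> [_ [_ [[b _ <-] _ _] <-]|_ [->|->]].
- by case: b; [left|right].
- by exists (path true).
- by exists (path false).
Qed.

Lemma no_arbitrage_symmetry_segment d' (f : 'rV[R]_d.+1 -> 'rV[R]_d'.+1) :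
  no_arbitrage_symmetry f ->
  (exists2 t : R, 0 < t < 1 & z = x + t *: (y - x)) ->
  let F v := persp (f (rV_cons 1 v)) in
  exists2 u : R, 0 < u < 1 & F z = F x + u *: (F y - F x).
Proof.
move=> f_sym zE; apply/two_point_arbitrage_free.
apply: (f_sym _ _ _ _ _ _ _ two_point_trajectory_set); first by exists true.
by apply/two_point_arbitrage_free; rewrite !persp_cons.
Qed.
End TwoPointMarket.

(** * Scaled linear forms and affine maps of the chart *)

Lemma noncollinear_persp d d' (f : 'rV[R]_d.+1 -> 'rV[R]_d'.+1)
    (F := fun v => persp (f (rV_cons 1 v))) (a b : 'rV[R]_d) :
  set_fun (dom_persp d) (dom_persp d') f -> scaling_condition f ->
  ~ (exists V : {vspace 'rV[R]_d'.+1},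
       \dim V = 2%N /\ forall s, dom_persp d s -> f s \in V) ->
  F a != F b -> exists p, forall u, F p != F a + u *: (F b - F a).
Proof.
move=> f_dom f_scal f_nc Fab; apply: contrapT => /forallNP F_line; apply: f_nc.
have {}F_line v : exists u, F v = F a + u *: (F b - F a).
  by have /existsNP[u /negP/negPn/eqP Fv] := F_line v; exists u.
(* The plane is the cone over the line through [F a] and [F b]; its dimension is exactly 2 because
   these points differ. *)
exists (<[rV_cons 1 (F a)]> + <[rV_cons 0 (F b - F a)]>)%VS; split.
  rewrite dimv_disjoint_sum.
    rewrite !dim_vline; have -> : rV_cons 1 (F a) != 0.
      apply/eqP => /rowP/(_ 0); rewrite rV_cons0 mxE => /eqP.
      by rewrite oner_eq0.
    suff -> : rV_cons 0 (F b - F a) != 0 by [].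
    apply: contra_neq Fab => /rowP c0; apply/rowP => i.
    by have := c0 (lift ord0 i); rewrite rV_consS !mxE => /subr0_eq.
  apply/eqP; rewrite -subv0; apply/subvP => w /memv_capP[/vlineP[k ->] /vlineP[l]].
  move=> /rowP/(_ 0); rewrite [RHS]mxE [LHS]mxE !rV_cons0 mulr1 mulr0 => ->.
  by rewrite scale0r mem0v.
move=> s s0; rewrite (dom_persp_consE (f_dom _ s0)) (persp_scaling f_scal s0).
rewrite -/(F _); have [u ->] := F_line (persp s).
apply: memvZ; have -> : rV_cons 1 (F a + u *: (F b - F a)) =
    rV_cons 1 (F a) + u *: rV_cons 0 (F b - F a).
  by rewrite [RHS]addrC rV_cons_comb mulr0 add0r [in RHS]addrC.
by rewrite memv_add// ?memvZ ?memv_line.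
Qed.

(** [L] is the homogenization of the affine map [F v = F 0 + D v], normalized so that its coordinate
    0 is s^0. *)
Lemma scaled_linear_of_affine d d' (f : 'rV[R]_d.+1 -> 'rV[R]_d'.+1)
    (F := fun v => persp (f (rV_cons 1 v))) :
  set_fun (dom_persp d) (dom_persp d') f -> scaling_condition f ->
  (forall a b t, F (a + t *: (b - a)) = F a + t *: (F b - F a)) ->
  scaled_linear_form f.
Proof.
move=> f_dom f_scal /affine_sub0_linear/linear_packed[D DE].
pose tl (s : 'rV[R]_d.+1) := \row_(i < d) s 0 (lift ord0 i).
have /linear_packed[L LE] :
    linear (fun s : 'rV[R]_d.+1 => rV_cons (s 0 0) (s 0 0 *: F 0 + D (tl s))).
  move=> c s t; rewrite rV_cons_comb !mxE.
  have -> : tl (c *: s + t) = c *: tl s + tl t by apply/rowP => i; rewrite !mxE.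
  rewrite (linearP D) scalerDl -scalerA; congr rV_cons.
  by rewrite [c *: (s 0 0 *: F 0 + _)]scalerDr addrACA.
have L0 s : L s 0 0 = s 0 0 by rewrite LE rV_cons0.
exists L; split.
- move=> s s0; rewrite L0 {1}(dom_persp_consE (f_dom _ s0)) (persp_scaling f_scal s0).
  rewrite -scalerA; congr (_ *: _).
  have s0' : s 0 0 != 0 by rewrite lt0r_neq0.
  have perspE : persp s = (s 0 0)^-1 *: tl s.
    by apply/rowP => i; rewrite !mxE mulrC.
  have FE v : F v = F 0 + D v by rewrite DE subrKC.
  rewrite -/(F _) perspE FE linearZ LE.
  by rewrite rV_consZ mulVf// scalerDr scalerA mulVf// scale1r.
- move=> s s0 c c0; have [mu mu0 E] := f_scal s s0 c c0.
  by exists mu => //; rewrite E mxE.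
- by move=> s s0; exact: (f_dom _ s0).
- by move=> s s0; rewrite L0.
Qed.

Lemma scaled_linear_symmetry d d' (f : 'rV[R]_d.+1 -> 'rV[R]_d'.+1) :
  scaled_linear_form f -> no_arbitrage_symmetry f.
Proof.
move=> [L [fE _ f0 L0]] W Sigma Omega Theta s0 w0 SS [_ SSP] T k ST.
have Lcons c (v : 'rV[R]_d) : L (rV_cons c v) = c *: L (rV_cons 1 0) + L (rV_cons 0 v).
  by rewrite -linearP rV_cons_comb mulr1 addr0 scaler0 add0r.
(* A linear form that is positive on the half-space s^0 > 0 is a multiple of s^0. *)
have L00 v : L (rV_cons 0 v) 0 0 = 0.
  set l := L _ 0 0; set c := L (rV_cons 1 0) 0 0.
  have c0 : 0 < c by apply: L0; exact: dom_persp_cons.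
  apply/eqP; apply: contraT => l0.
  (* The factor [- (c / l)] is chosen so that L^0 vanishes at a point of the open half-space. *)
  have := L0 (rV_cons 1 (- (c / l) *: v)) (dom_persp_cons _).
  have -> : rV_cons 1 (- (c / l) *: v) = - (c / l) *: rV_cons 0 v + rV_cons 1 0.
    by rewrite rV_cons_comb mulr0 add0r addr0.
  by rewrite linearP !mxE -/l -/c mulNr divfK// addNr ltxx.
set c := L (rV_cons 1 0) 0 0.
have /linear_packed[B BE] :
    linear (fun v : 'rV[R]_d => \row_(i < d') (L (rV_cons 0 v) 0 (lift ord0 i) / c)).
  move=> a u v; apply/rowP => i; rewrite !mxE mulrA -mulrDl.
  have -> : rV_cons 0 (a *: u + v) = a *: rV_cons 0 u + rV_cons 0 v.
    by rewrite rV_cons_comb mulr0 addr0.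
  by rewrite linearP !mxE.
have perspf s : dom_persp d s -> persp (f s) = persp (L (rV_cons 1 0)) + B (persp s).
  move=> s_dom; rewrite fE// persp_scale; last first.
    by rewrite lt0r_neq0// divr_gt0 ?f0 ?L0.
  rewrite (dom_persp_consE s_dom) linearZ persp_scale; last by rewrite lt0r_neq0.
  rewrite persp_scale ?persp_cons; last by rewrite lt0r_neq0.
  rewrite (Lcons 1 (persp s)) scale1r; apply/rowP => i; rewrite BE !mxE L00 addr0 -/c.
  by rewrite mulrDl.
(* In a difference of two prices the constant term of the affine map cancels, so the transformed
   increments are the image of [A] under the linear part [B]. *)
pose A := [set persp (asset T' k.+1) - persp (asset T k) | T' in node SS T k].
rewrite /arbitrage_free /arbitrage_free_via.
have -> : [set persp (f (asset T' k.+1)) - persp (f (asset T k))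
          | T' in node SS T k] = B @` A.
  have E T' : node SS T k T' -> persp (f (asset T' k.+1)) - persp (f (asset T k)) =
      B (persp (asset T' k.+1) - persp (asset T k)).
    move=> [ST' _ _]; have [_ _ _ dT'] := SSP _ ST'; have [_ _ _ dT] := SSP _ ST.
    by rewrite !perspf// linearB opprD addrACA subrr add0r.
  apply/seteqP; split=> [_ [T' nT' <-]|_ [_ [T' nT' <-] <-]].
    by rewrite E//; eexists => //; exists T'.
  by exists T' => //; rewrite E.
move=> /relative_interior_hull0[[a Aa] hA]; apply/relative_interior_hull0; split.
  by exists (B a); exists a.
move=> _ [v Av <-]; have [e e0 Ae] := hA v Av; exists e => //.
by rewrite -linearZ; exact: convex_hull_linear.
Qed.
End Perspective.

Theorem corollary1 (R : realType) (d d' : nat)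
    (f : 'rV[R]_d.+1 -> 'rV[R]_d'.+1)
    (d_ge1 : (1 <= d)%N) (d'_ge1 : (1 <= d')%N)
    (f_dom : set_fun (dom_persp d) (dom_persp d') f)
    (f_scaling : scaling_condition f) :
  (no_arbitrage_symmetry f ->
   ~ (exists V : {vspace 'rV[R]_d'.+1},
        \dim V = 2%N /\ forall s, dom_persp d s -> f s \in V) ->
   scaled_linear_form f) /\
  (scaled_linear_form f -> no_arbitrage_symmetry f).
Proof.
split; last exact: scaled_linear_symmetry.
move=> f_sym f_nc; apply: scaled_linear_of_affine => // a b t.
apply: (@segment_map_affine R _ _ (fun v => persp (f (rV_cons 1 v)))).
  move=> x y c c01; apply: no_arbitrage_symmetry_segment => //.
  by exists c.
by move=> a' b'; exact: noncollinear_persp.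
Qed.
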